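(* Let $C$ be a convexly compact subset of a topological vector space $X$, and let $D\subseteq C$ be convex and closed. Let the mapping $F:C\times D\to\mathbb R$ satisfy the following properties: 1. for each $y\in D$, the set $\{x\in C: F(x,y)\le 0\}$ is closed and convex; 2. for each $x\in C$, the function $y\mapsto F(x,y)$ is concave; and 3. for each $y\in D$, $F(y,y)\le 0$. Then there exists $x_0\in C$ such that $F(x_0,y)\le 0$ for all $y\in D$.
   Context: A convex subset $C$ of a topological vector space $X$ is said to be convexly compact if for any non-empty set $A$ and any family $\{F_\alpha\}_{\alpha\in A}$ of closed and convex subsets of $C$, the condition that $\bigcap_{\alpha\in E}F_\alpha\neq\emptyset$ for every non-empty finite subset $E$ of $A$ implies $\bigcap_{\alpha\in A}F_\alpha\neq\emptyset$. *)

(* Defs.v *)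
From mathcomp Require Import all_boot all_order all_algebra.
From mathcomp Require Import boolp classical_sets functions cardinality.
From mathcomp Require Import interval_inference reals topology convex tvs.

Set Implicit Arguments.
Unset Strict Implicit.
Unset Printing Implicit Defensive.

Import Order.TTheory GRing.Theory Num.Theory.

Local Open Scope classical_set_scope.
Local Open Scope ring_scope.
Local Open Scope convex_scope.

(* In [subspace C] the points outside C are isolated, so for A `<=` C this says
   that A is closed for the topology induced on C: A = C `&` K for some K
   closed in T (see [closed_subspaceP]). C itself need not be closed in T. *)
Definition closed_in (T : topologicalType) (C A : set T) : Prop :=
  closed (A : set (subspace C)).

(* Mirrors [convex_function], with the inequality reversed. *)
Definition concave_function (R : numFieldType) (E : lmodType R)
    (E' := convex_lmodType E) (D : set E') (f : E' -> R^o) : Prop :=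
  forall t : {i01 R},
    {in D &, forall x y : E', f x <| t |> f y <= f (x <| t |> y)}.

(* X is only a topological vector space; the library's [tvsType] would add
   local convexity. *)
Definition convexly_compact (R : realType) (X : topologicalLmodType R)
    (C : set X) : Prop :=
  convex_set C /\
  forall (I : Type) (A : set I) (F : I -> set X),
    A !=set0 ->
    (forall a, A a -> [/\ F a `<=` C, closed_in C (F a) & convex_set (F a)]) ->
    (forall E : set I, E `<=` A -> E !=set0 -> finite_set E ->
       (\bigcap_(a in E) F a) !=set0) ->
    (\bigcap_(a in A) F a) !=set0.

(* Main.v *)
Require Import Defs.
From mathcomp Require Import all_boot all_order all_algebra.
From mathcomp Require Import boolp classical_sets functions cardinality.
From mathcomp Require Import interval_inference reals topology convex tvs.
From mathcomp Require Import unstable ring lra.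
From mathcomp Require Import pseudometric_normed_Zmodule normed_module.

(* Put G y = {x in C | F x y <= 0}. By convex compactness it suffices that
   finitely many of the convex closed sets G y meet. Induct on their number, the
   claim being made for all points of D at once. Given a, b in D and the
   intersection K of the other sets, suppose that K, G a and G b have no common
   point. For every z in the segment [a, b] the set K `&` G z is nonempty (by
   induction), convex, and covered by G a and G b (by concavity), so by
   connectedness it meets exactly one of them. Moving z from a to b, the set of
   parameters for which it meets G a is an initial interval, and concavity and
   convex compactness make it closed; by symmetry so is its complement, which
   contradicts the connectedness of [0, 1]. *)

Set Implicit Arguments.
Unset Strict Implicit.
Unset Printing Implicit Defensive.

Import Order.TTheory GRing.Theory Num.Theory.
Import numFieldTopology.Exports.

Local Open Scope classical_set_scope.
Local Open Scope ring_scope.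

(** * Segments and convex sets *)

Definition segment_point (R : realType) (X : lmodType R) (a b : X) (t : R) : X :=
  (1 - t) *: a + t *: b.

Lemma segment_point0 (R : realType) (X : lmodType R) (a b : X) :
  segment_point a b 0 = a.
Proof. by rewrite /segment_point subr0 scale1r scale0r addr0. Qed.

Lemma segment_point1 (R : realType) (X : lmodType R) (a b : X) :
  segment_point a b 1 = b.
Proof. by rewrite /segment_point subrr scale1r scale0r add0r. Qed.

Lemma segment_pointC (R : realType) (X : lmodType R) (a b : X) (t : R) :
  segment_point a b t = segment_point b a (1 - t).
Proof. by rewrite /segment_point subKr addrC. Qed.

Lemma segment_pointA (R : realType) (X : lmodType R) (a b : X) (s t u : R) :
  segment_point (segment_point a b s) (segment_point a b t) u =
  segment_point a b ((1 - u) * s + u * t).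
Proof.
rewrite /segment_point !scalerDr !scalerA addrACA -!scalerDl.
by congr (_ *: _ + _ *: _); ring.
Qed.

(** [conv] puts the weight [t] on its first point, while [segment_point] runs from [a] at 0 to [b]
    at 1; hence the reversed parameter. *)
Lemma segment_point_conv (R : realType) (X : lmodType R) (a b : X) (t : {i01 R}) :
  conv t (a : convex_lmodType X) (b : convex_lmodType X) =
  segment_point a b (1 - t%:num).
Proof. by rewrite /segment_point subKr. Qed.

Lemma convex_setP (R : realType) (X : lmodType R) (A : set X) :
  convex_set A <->
  forall x y t, A x -> A y -> 0 <= t <= 1 -> A (segment_point x y t).
Proof.
split=> [cA x y t Ax Ay /andP[t0 t1]|cA x y t /set_mem Ax /set_mem Ay].
  have h0 : 0 <= 1 - t by lra.
  have h1 : 1 - t <= 1 by lra.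
  have := cA x y (Itv01 h0 h1) (mem_set Ax) (mem_set Ay).
  by rewrite segment_point_conv /= subKr => /set_mem.
apply/mem_set; rewrite segment_point_conv; apply: cA => //.
by rewrite subr_ge0 gerBl le1 ge0.
Qed.

Lemma convex_setI2 (R : realType) (X : lmodType R) (A B : set X) :
  convex_set A -> convex_set B -> convex_set (A `&` B).
Proof.
move=> /convex_setP cA /convex_setP cB; apply/convex_setP => x y t [Ax Bx] [Ay By] t01.
by split; [exact: cA|exact: cB].
Qed.

(** * Concave functions on the unit interval *)

Definition concave01 (R : realType) (f : R -> R) : Prop :=
  forall s t u, 0 <= s <= 1 -> 0 <= t <= 1 -> 0 <= u <= 1 ->
    (1 - u) * f s + u * f t <= f ((1 - u) * s + u * t).

Lemma concave_segment (R : realType) (X : lmodType R) (D : set X) (f : X -> R)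
    (a b : X) :
  convex_set D -> concave_function D f -> D a -> D b ->
  concave01 (fun t => f (segment_point a b t)).
Proof.
move=> /convex_setP cD cf Da Db s t u s01 t01 /andP[u0 u1].
have h0 : 0 <= 1 - u by lra.
have h1 : 1 - u <= 1 by lra.
have := cf (Itv01 h0 h1) (segment_point a b s) (segment_point a b t).
rewrite segment_point_conv /= subKr segment_pointA convRE /= /onem subKr.
by apply; apply/mem_set; exact: cD.
Qed.

(** If [f] were positive at [t], it would be positive at both ends of [[t, 1]], hence at [s] by
    concavity. This makes the sets used for convex compactness decrease along the segment. *)
Lemma concave01_le0_left (R : realType) (f : R -> R) (t s : R) :
  concave01 f -> 0 < f 1 -> 0 <= t -> t <= s -> s <= 1 -> f s <= 0 -> f t <= 0.
Proof.
move=> cf f1 t0 ts s1 fs; rewrite leNgt; apply/negP => ft.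
have t1 : t < 1.
  rewrite lt_neqAle (le_trans ts s1) andbT; apply/eqP => t1.
  by have e : s = 1; [lra|rewrite e in fs; lra].
have d0 : 0 < 1 - t by lra.
(* The weight of 1 when [s] is written as a convex combination of [t] and 1. *)
pose u := (s - t) / (1 - t).
have u0 : 0 <= u by apply: divr_ge0; lra.
have u1 : u <= 1 by rewrite ler_pdivrMr//; lra.
have us : (1 - u) * t + u * 1 = s by rewrite /u; field; rewrite gt_eqF.
have := cf t 1 u; rewrite us (ltW t1) t0 ler01 lexx u0 u1.
by move=> /(_ isT isT isT); nra.
Qed.

(** Concavity replaces continuity here: were [f s] positive, the chord from 0 to [s] would bound [f]
    below by a positive value just left of [s]. *)
Lemma concave01_le0_limit (R : realType) (f : R -> R) (s : R) :
  concave01 f -> 0 < s -> s <= 1 -> (forall t, 0 <= t -> t < s -> f t <= 0) ->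
  f s <= 0.
Proof.
move=> cf s0 s1 fle; rewrite leNgt; apply/negP => fs.
have f0 : f 0 <= 0 by exact: fle.
(* Chosen so that the chord takes the value [f s / 2] at [(1 - e) * s]. *)
pose e := f s / (2 * (f s - f 0)).
have d0 : 0 < 2 * (f s - f 0) by lra.
have e0 : 0 < e by exact: divr_gt0.
have e1 : e < 1 by rewrite ltr_pdivrMr//; lra.
have ee : (1 - e) * f s + e * f 0 = f s / 2.
  by rewrite /e; field; rewrite gt_eqF//; lra.
have := cf s 0 e; rewrite ee mulr0 addr0 (ltW s0) s1 lexx ler01 (ltW e0) (ltW e1).
move=> /(_ isT isT isT).
have : f ((1 - e) * s) <= 0 by apply: fle; nra.
lra.
Qed.

(** * Connectedness along segments *)

Lemma segment_point_continuous (R : realType) (X : topologicalLmodType R) (a b : X) :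
  continuous (segment_point a b : R^o -> X).
Proof.
move=> t.
apply: (@continuous_comp _ _ _ (fun t : R^o => ((1 - t) *: a, t *: b))
  (fun x : X * X => x.1 + x.2)); last exact: tvs.add_continuous.
apply: cvg_pair => /=.
  apply: (@continuous_comp _ _ _ (fun t : R^o => (1 - t : R^o, a))
    (fun z : R^o * X => z.1 *: z.2)); last exact: tvs.scale_continuous.
  apply: (@cvg_pair _ _ _ _ (nbhs (1 - t : R^o))); last exact: cvg_cst.
  by apply: cvgB; [exact: cvg_cst|exact: cvg_id].
apply: (@continuous_comp _ _ _ (fun t : R^o => (t, b))
  (fun z : R^o * X => z.1 *: z.2)); last exact: tvs.scale_continuous.
by apply: (@cvg_pair _ _ _ _ (nbhs (t : R^o))); [exact: cvg_id|exact: cvg_cst].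
Qed.

(** A segment in [M] from a point of [A] to a point of [B] is connected, so two disjoint relatively
    closed sets cannot split it. *)
Lemma convex_closed_cover_meet (R : realType) (X : topologicalLmodType R)
    (C M A B : set X) :
  closed_in C A -> closed_in C B -> convex_set M -> M `<=` C ->
  M `<=` A `|` B -> (M `&` A) !=set0 -> (M `&` B) !=set0 ->
  (M `&` A `&` B) !=set0.
Proof.
move=> /closed_subspaceP[V cV VA] /closed_subspaceP[W cW WB] /convex_setP cM.
move=> MC MAB [p [Mp Ap]] [q [Mq Bq]]; apply/set0P/eqP => MAB0.
(* [V] and [W] are closed in [X] itself and agree with [A] and [B] on [M], so they can be pulled
   back along the segment. *)
have inV x : M x -> V x <-> A x.
  move=> Mx; have Cx := MC _ Mx; split=> h.
    by have [] : (A `&` C) x by rewrite -VA.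
  by have [] : (V `&` C) x by rewrite VA.
have inW x : M x -> W x <-> B x.
  move=> Mx; have Cx := MC _ Mx; split=> h.
    by have [] : (B `&` C) x by rewrite -WB.
  by have [] : (W `&` C) x by rewrite WB.
pose f : R -> X := segment_point p q.
have cf : continuous f by exact: segment_point_continuous.
have Mf t : `[0, 1]%classic t -> M (f t).
  by move=> /=; rewrite in_itv /= => t01; exact: cM.
have disj x : M x -> A x -> B x -> False.
  by move=> Mx Ax Bx; have : (M `&` A `&` B) x by []; rewrite MAB0.
have i0 : `[0, 1]%classic (0 : R) by rewrite /= in_itv /= lexx ler01.
have i1 : `[0, 1]%classic (1 : R) by rewrite /= in_itv /= lexx ler01.
(* The trace of [V] is nonempty, relatively closed, and relatively open as the complement of the
   trace of [W]; hence it is all of [[0, 1]], and [q] falls into [A]. *)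
have e : `[0, 1]%classic `&` f @^-1` V = `[0, 1]%classic.
  apply: (@segment_connected R 0 1).
  - exists 0; split => //=; apply/inV; first exact: Mf.
    by rewrite /f segment_point0.
  - exists (~` (f @^-1` W)).
      by apply: closed_openC; apply: preimage_closed.
    apply/seteqP; split=> t [t01 h]; split=> //=; have Mt := Mf _ t01.
      by move=> /(inW _ Mt); apply: disj => //; exact/(inV _ Mt).
    by apply/(inV _ Mt); have [//|Bt] := MAB _ Mt; case: h; exact/(inW _ Mt).
  - by exists (f @^-1` V) => //; apply: preimage_closed.
have [_] : (`[0, 1]%classic `&` f @^-1` V) 1 by rewrite e.
rewrite /f /= segment_point1 => Vq.
exact: (disj q Mq ((inV _ Mq).1 Vq) Bq).
Qed.

(** * Intersections of the sublevel sets *)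

Lemma closed_inI (T : topologicalType) (C A B : set T) :
  closed_in C A -> closed_in C B -> closed_in C (A `&` B).
Proof. exact: (@closedI (subspace C)). Qed.

Lemma finite_set_max (R : realType) (E : set R) :
  E !=set0 -> finite_set E -> exists2 m, E m & forall t, E t -> t <= m.
Proof.
move=> [x Ex] /finite_seqP[s Es]; subst E; move: x Ex => /=.
elim: s => [//|y s IHs] _ _.
case: s IHs => [_|z s IHs].
  by exists y => [|t] /=; rewrite inE // => /eqP ->.
have [|m ms mub] := IHs z; first by rewrite /= inE eqxx.
exists (Num.max y m).
  by rewrite /= /Num.max; case: ifP; rewrite inE ?ms ?orbT ?eqxx.
move=> t /=; rewrite inE => /orP[/eqP ->|/mub tm]; rewrite le_max ?lexx//.
by rewrite tm orbT.
Qed.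

(** The closedness argument: convex compactness yields one [x] that serves all parameters [t < s],
    and concavity of [F x] along the segment then carries the inequality to [s]. *)
Lemma meet_left_closed (R : realType) (X : topologicalLmodType R) (C D K : set X)
    (F : X -> X -> R) (a b : X) (s : R) :
  convexly_compact C -> convex_set D ->
  (forall y, D y ->
     closed_in C [set x | C x /\ F x y <= 0] /\
     convex_set [set x | C x /\ F x y <= 0]) ->
  (forall x, C x -> concave_function D (F x)) ->
  K `<=` C -> closed_in C K -> convex_set K -> D a -> D b ->
  (forall x, K x -> F x a <= 0 -> F x b <= 0 -> False) ->
  0 < s -> s <= 1 ->
  (forall t, 0 <= t -> t < s ->
     exists x, [/\ K x, F x (segment_point a b t) <= 0 & F x a <= 0]) ->
  exists x, [/\ K x, F x (segment_point a b s) <= 0 & F x a <= 0].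
Proof.
move=> [_ cC] cD cG cF KC clK cK Da Db disj s0 s1 meet.
pose H t := K `&` [set x | C x /\ F x (segment_point a b t) <= 0]
              `&` [set x | C x /\ F x a <= 0].
have ccF x : K x -> concave01 (fun t => F x (segment_point a b t)).
  by move=> /KC /cF cFx; exact: concave_segment cD cFx Da Db.
have Dseg (t : R) : 0 <= t -> t < s -> D (segment_point a b t).
  move=> t0 ts; move/convex_setP: cD; apply => //.
  by rewrite t0 ltW//; exact: lt_le_trans ts s1.
have [||E EA E0 finE|x Hx] := cC R [set t | 0 <= t /\ t < s] H.
- by exists 0.
- move=> t [t0 ts]; have [cl1 co1] := cG _ (Dseg _ t0 ts); have [cl2 co2] := cG _ Da.
  split; first by move=> x [[/KC]].
    by apply: closed_inI => //; exact: closed_inI.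
  by apply: convex_setI2 => //; exact: convex_setI2.
(* A point for the largest parameter [m] of the finite family serves the smaller ones too, because
   [disj] makes [F x b] positive. *)
- have [m Em mub] := finite_set_max E0 finE.
  have [m0 ms] := EA _ Em; have [x [Kx xm xa]] := meet m m0 ms.
  have Cx := KC _ Kx.
  exists x => t Et; have [t0 ts] := EA _ Et.
  split; split => //; split => //.
  apply: (concave01_le0_left (ccF _ Kx) _ t0 (mub _ Et)) => //; last by lra.
  by rewrite segment_point1 ltNge; apply/negP; exact: disj.
- have [[Kx _] [_ xa]] : H 0 x by apply: Hx.
  exists x; split => //; apply: (concave01_le0_limit (ccF _ Kx)) => // t t0 ts.
  by have [[_ []]] : H t x by apply: Hx.
Qed.

(** The induction step: [K] stands for the intersection of all the other sets, and [meetK] for the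
    induction hypothesis. *)
Lemma meet_two (R : realType) (X : topologicalLmodType R) (C D K : set X)
    (F : X -> X -> R) (a b : X) :
  convexly_compact C -> convex_set D ->
  (forall y, D y ->
     closed_in C [set x | C x /\ F x y <= 0] /\
     convex_set [set x | C x /\ F x y <= 0]) ->
  (forall x, C x -> concave_function D (F x)) ->
  K `<=` C -> closed_in C K -> convex_set K ->
  (forall y, D y -> exists x, K x /\ F x y <= 0) ->
  D a -> D b -> exists x, [/\ K x, F x a <= 0 & F x b <= 0].
Proof.
move=> cC cD cG cF KC clK cK meetK Da Db; apply: contrapT => nmeet.
have disj x : K x -> F x a <= 0 -> F x b <= 0 -> False.
  by move=> Kx xa xb; apply: nmeet; exists x.
have Dseg (t : R) : 0 <= t <= 1 -> D (segment_point a b t).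
  by move=> t01; move/convex_setP: (cD); apply.
have cover x (t : R) : K x -> 0 <= t <= 1 -> F x (segment_point a b t) <= 0 ->
    F x a <= 0 \/ F x b <= 0.
  move=> Kx /andP[t0 t1] xt; have [xa|xa] := leP (F x a) 0; first by left.
  right; rewrite leNgt; apply/negP => xb.
  have := @concave_segment _ _ _ _ a b cD (cF _ (KC _ Kx)) Da Db 0 1 t.
  rewrite /= segment_point0 segment_point1 mulr0 add0r mulr1 !lexx ler01 t0 t1.
  by move=> /(_ isT isT isT); nra.
(* [c] will be either endpoint: [P c t] says that [K] and the sublevel sets of the point at [t] and
   of [c] have a common point. *)
pose P c t := exists x, [/\ K x, F x (segment_point a b t) <= 0 & F x c <= 0].
have Pab (t : R) : 0 <= t <= 1 -> P a t \/ P b t.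
  move=> t01; have [x [Kx xt]] := meetK _ (Dseg _ t01).
  by have [h|h] := cover _ _ Kx t01 xt; [left|right]; exists x.
have Pdisj (t : R) : 0 <= t <= 1 -> P a t -> P b t -> False.
  move=> t01 [p [Kp pt pa]] [q [Kq qt qb]].
  have [cla coa] := cG _ Da; have [clb cob] := cG _ Db.
  have [clt cot] := cG _ (Dseg _ t01).
  have [|||||x [[[Kx _] [_ xa]] [_ xb]]] := @convex_closed_cover_meet _ _ _
    (K `&` [set x | C x /\ F x (segment_point a b t) <= 0]) _ _ cla clb.
  - exact: convex_setI2.
  - by move=> x [/KC].
  - move=> x [Kx [Cx xt]].
    by have [h|h] := cover _ _ Kx t01 xt; [left|right].
  - by exists p; do !split => //; exact: KC.
  - by exists q; do !split => //; exact: KC.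
  - exact: disj Kx xa xb.
have Pa0 : P a 0.
  by have [x [Kx xa]] := meetK _ Da; exists x; rewrite segment_point0.
have Pb1 : P b 1.
  by have [x [Kx xb]] := meetK _ Db; exists x; rewrite segment_point1.
have Pleft (t s : R) : 0 <= t -> t <= s -> s <= 1 -> P a s -> P a t.
  move=> t0 ts s1 [x [Kx xs xa]]; exists x; split => //.
  have := @concave01_le0_left R (fun t => F x (segment_point a b t)) t s.
  apply => //; first exact: concave_segment (cF _ (KC _ Kx)) Da Db.
  by rewrite segment_point1 ltNge; apply/negP; exact: disj.
pose S := [set t | (0 <= t <= 1) /\ P a t].
have S0 : S 0 by split; rewrite ?lexx ?ler01.
have ubS : ubound S 1 by move=> t [/andP[]].
pose m := sup S.
have m0 : 0 <= m by apply: ub_le_sup => //; exists 1.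
have m1 : m <= 1 by apply: ge_sup => //; exists 0.
have Pam (t : R) : 0 <= t -> t < m -> P a t.
  move=> t0 /(sup_gt (ex_intro _ _ S0)) [s [/andP[_ s1] Pas] /ltW ts].
  exact: Pleft ts s1 Pas.
have Pbm (t : R) : m < t -> t <= 1 -> P b t.
  move=> mt t1; have t01 : 0 <= t <= 1 by rewrite t1 (le_trans m0 (ltW mt)).
  have [Pat|//] := Pab _ t01.
  have : t <= m by apply: ub_le_sup => //; exists 1.
  by rewrite leNgt mt.
(* The threshold [m] belongs to both sides: to [P a] as a limit from the left, to [P b] as a limit
   from the right. The extreme cases [m = 0] and [m = 1] are [Pa0] and [Pb1]. *)
apply: (Pdisj m); first by rewrite m0.
- have [mpos|] := ltP 0 m; last by move=> h; have -> : m = 0 by lra.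
  exact: meet_left_closed cC cD cG cF KC clK cK Da Db disj mpos m1 Pam.
- have [mlt|] := ltP m 1; last by move=> h; have -> : m = 1 by lra.
  (* Reversing the segment turns the limit from the right at [m] into one from the left at
     [1 - m]. *)
  rewrite /P segment_pointC.
  apply: (meet_left_closed cC cD cG cF KC clK cK Db Da); try lra.
    by move=> x Kx xb xa; exact: disj Kx xa xb.
  by move=> t t0 tm; rewrite segment_pointC; apply: Pbm; lra.
Qed.

Lemma meet_finite (R : realType) (X : topologicalLmodType R) (C D : set X)
    (F : X -> X -> R) (s : seq X) :
  C !=set0 -> convexly_compact C -> D `<=` C -> convex_set D ->
  (forall y, D y ->
     closed_in C [set x | C x /\ F x y <= 0] /\
     convex_set [set x | C x /\ F x y <= 0]) ->
  (forall x, C x -> concave_function D (F x)) ->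
  (forall y, D y -> F y y <= 0) ->
  (forall y, y \in s -> D y) ->
  exists x, C x /\ forall y, y \in s -> F x y <= 0.
Proof.
move=> [c Cc] cC DC cD cG cF Fyy.
(* The list is generalized under a bound on its size, since the hypothesis will be applied to
   [y :: s] for every [y] in [D], not just to sublists of [a :: b :: s]. *)
elim: {s}(size s).+1 {-2}s (ltnSn (size s)) => // n IHn [|a [|b s]] sn Ds.
- by exists c.
- have Da : D a by apply: Ds; rewrite inE.
  by exists a; split; [exact: DC|move=> y; rewrite inE => /eqP ->; exact: Fyy].
- pose K := [set x | C x /\ forall y, y \in s -> F x y <= 0].
  (* As an intersection, with [C] kept as a factor for the case of empty [s], [K] inherits
     closedness and convexity. *)
  have KE : K = C `&` \bigcap_(y in [set` s]) [set x | C x /\ F x y <= 0].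
    apply/seteqP; split=> x [Cx h]; split=> // y ys; first by split => //; exact: h.
    by have [] := h y ys.
  have Dss y : y \in s -> D y by move=> ys; apply: Ds; rewrite !inE ys !orbT.
  have Da : D a by apply: Ds; rewrite inE eqxx.
  have Db : D b by apply: Ds; rewrite !inE eqxx orbT.
  have [||||||x [[Cx xs] xa xb]] := @meet_two _ _ _ _ K _ a b cC cD cG cF.
  + by move=> x [].
  + rewrite KE; apply: closed_inI; first exact: closed_subspaceT.
    by apply: (@closed_bigI (subspace C)) => y ys; exact: (cG _ (Dss _ ys)).1.
  + rewrite KE; apply: convex_setI2; first exact: cC.1.
    apply/convex_setP => x y t hx hy t01 z zs.
    have /convex_setP := (cG _ (Dss _ zs)).2; apply => //; [exact: hx|exact: hy].
  + move=> y Dy; have [||x [Cx xs]] := IHn (y :: s).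
    * by move: sn.
    * by move=> z; rewrite inE => /orP[/eqP ->|/Dss].
    * exists x; split; last by apply: xs; rewrite inE eqxx.
      by split => // z zs; apply: xs; rewrite inE zs orbT.
  + exact: Da.
  + exact: Db.
  + exists x; split => // y; rewrite !inE => /or3P[/eqP ->|/eqP ->|] //.
    exact: xs.
Qed.

Theorem theorem4p11 (R : realType) (X : topologicalLmodType R) (C D : set X)
    (F : X -> X -> R) :
  C !=set0 ->
  convexly_compact C ->
  D `<=` C ->
  convex_set D ->
  closed_in C D ->
  (forall y, D y ->
     closed_in C [set x | C x /\ F x y <= 0] /\
     convex_set [set x | C x /\ F x y <= 0]) ->
  (forall x, C x -> concave_function D (F x)) ->
  (forall y, D y -> F y y <= 0) ->
  exists x0, C x0 /\ forall y, D y -> F x0 y <= 0.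
Proof.
move=> C0 cC DC cD _ cG cF Fyy.
(* Convex compactness requires a nonempty index set; for empty [D] any point of [C] will do. *)
have [[d Dd]|D0] := pselect (D !=set0); last first.
  by case: C0 => c Cc; exists c; split => // y Dy; case: D0; exists y.
have [|y Dy|E ED _ /finite_seqP[s Es]|x Hx] :=
    cC.2 X D (fun y => [set x | C x /\ F x y <= 0]).
- by exists d.
- by have [] := cG _ Dy; split => // x [].
- subst E; have [x [Cx xs]] := meet_finite C0 cC DC cD cG cF Fyy ED.
  by exists x => y ys; split => //; exact: xs.
- by exists x; split => [|y Dy]; [have [] := Hx _ Dd|have [] := Hx _ Dy].
Qed.
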